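(* Let $D$ be an Arakelov divisor on $\overline{\operatorname{Spec}{\mathbb Z}}$ with $\deg(D)\geq 0$. Then $$\dim_{\mathbb S} H^0(D)=\lceil \deg_2 D\rceil+1,$$ where $\deg_2 D:=\deg(D)/\log 2$ and $\lceil x\rceil$ denotes the smallest integer strictly greater than $x$.
   Context: An Arakelov divisor on $\overline{\operatorname{Spec}{\mathbb Z}}$ is a formal sum $D=\sum_p a_p\{p\}+a_\infty\{\infty\}$ (finitely many nonzero $a_p\in{\mathbb Z}$, $a_\infty\in{\mathbb R}$), with $\deg D=\sum_p a_p\log p+a_\infty$. Its $H^0(D)$ is the ${\mathbb S}$-module which (via the classical relation between the degree and the associated compact subset of adeles, after reduction to $D=\deg(D)\{\infty\}$) is the ${\mathbb S}$-module $(H{\mathbb Z})_I$ with $I=[-e^{\deg D},e^{\deg D}]\cap{\mathbb Z}$, where for $X\subset{\mathbb Z}$ containing $0$, $(H{\mathbb Z})_X(k_+)=\{a\in{\mathbb Z}^k\mid \sum_{j\in Z}a_j\in X\ \forall Z\subset\{1,\dots,k\}\}$ (with $k_+=\{*,1,\dots,k\}$). Its dimension $\dim_{\mathbb S}$ is the smallest cardinality of a subset $G\subset I$ such that for every $x\in I$ there is $Z\subset G$ with $\sum_{g\in Z}g=x$ and $\sum_{g\in Z'}g\in I$ for all $Z'\subset Z$. *)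

(* Defs.v *)
From HB Require Import structures.
From mathcomp Require Import all_boot all_order all_algebra.
From mathcomp Require Import finmap.
From mathcomp Require Import all_classical all_reals all_analysis.

Set Implicit Arguments.
Unset Strict Implicit.
Unset Printing Implicit Defensive.

Import Order.TTheory GRing.Theory Num.Theory.
Local Open Scope classical_set_scope.
Local Open Scope ring_scope.

Definition is_least {d : Order.disp_t} {T : porderType d} (A : set T) (m : T) :
    Prop :=
  A m /\ forall n, A n -> (m <= n)%O.

(* The smallest integer strictly greater than x (so strict_ceil 0 = 1). *)
Definition strict_ceil {R : realType} (x : R) : int :=
  xget 0 (is_least [set m : int | x < m%:~R]).

Lemma strict_ceil_least (R : realType) (x : R) :
  is_least [set m : int | x < m%:~R] (strict_ceil x).
Proof.
apply: (@xgetPex _ 0 (is_least [set m : int | x < m%:~R])).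
exists (Num.floor x + 1); split => [|n] /=; first exact: floorD1_gt.
by move=> xn; rewrite lezD1 -(ltr_int R); apply: le_lt_trans xn; apply: floor_le.
Qed.

(* A finitely supported integer coefficient at each prime p, and a real one at
   the archimedean place. *)
Record arakelov_divisor (R : realType) := ArakelovDivisor {
  fin_coef : {fsfun {p : nat | prime p} -> int with 0};
  inf_coef : R }.

Definition deg {R : realType} (D : arakelov_divisor R) : R :=
  \sum_(p <- finsupp (fin_coef D)) (fin_coef D p)%:~R * ln (val p)%:R
  + inf_coef D.

Definition deg2 {R : realType} (D : arakelov_divisor R) : R := deg D / ln 2.

(* A pointed map k_+ -> n_+ is given by phi : 'I_k -> option 'I_n, with None
   the base point of n_+; this is its action HZ(k_+) -> HZ(n_+). *)
Definition HZ_map {k n : nat} (phi : 'I_k -> option 'I_n) (a : 'I_k -> int) :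
    'I_n -> int :=
  fun j => \sum_(i | phi i == Some j) a i.

(* Sub-S-modules of the Eilenberg-MacLane S-module HZ : k_+ |-> Z^k. *)
Record subSmod := SubSmod {
  level :> forall k : nat, set ('I_k -> int);
  level0 : forall k, level (fun _ : 'I_k => 0);
  level_map : forall k n (phi : 'I_k -> option 'I_n) (a : 'I_k -> int),
    level a -> level (HZ_map phi a) }.

Definition HZ_level (X : set int) (k : nat) : set ('I_k -> int) :=
  [set a | forall Z : {set 'I_k}, X (\sum_(j in Z) a j)].

Lemma HZ_level0 (X : set int) (X0 : X 0) k : HZ_level X (fun _ : 'I_k => 0).
Proof. by move=> Z; rewrite big1. Qed.

Lemma HZ_level_map (X : set int) k n (phi : 'I_k -> option 'I_n)
  (a : 'I_k -> int) : HZ_level X a -> HZ_level X (HZ_map phi a).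
Proof.
move=> aX Z; have := aX [set i | if phi i is Some j then j \in Z else false]%SET.
congr (X _); rewrite /HZ_map (exchange_big_dep predT) //= big_mkcond /=.
apply: eq_bigr => i _; rewrite inE; case: (phi i) => [j|]; last first.
  by rewrite big_pred0 // => j; rewrite andbF.
case: ifPn => jZ.
  by rewrite (big_pred1 j) // => l; apply/andP/eqP => [[_ /eqP[]]|->].
rewrite big_pred0 // => l; apply/negP => /andP[lZ /eqP[jl]].
by rewrite jl lZ in jZ.
Qed.

Definition HZ_sub (X : set int) (X0 : X 0) : subSmod :=
  SubSmod (HZ_level0 X0) (@HZ_level_map X).

Definition level1 (M : subSmod) : set int := [set x | M 1 (fun=> x)].

Lemma level1_HZ_sub (X : set int) (X0 : X 0) : level1 (HZ_sub X0) = X.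
Proof.
apply/seteqP; split => [x /(_ [set: 'I_1]%SET)|x Xx Z] /=.
  by rewrite (big_pred1 ord0) // => i; rewrite inE /= ord1.
have [->|[i iZ]] := set_0Vmem Z; first by rewrite big_set0.
rewrite (_ : Z = [set i]%SET) ?big_set1//.
by apply/setP => j; rewrite inE !ord1 eqxx -(ord1 i).
Qed.

Definition divisor_interval {R : realType} (D : arakelov_divisor R) : set int :=
  [set n | - expR (deg D) <= n%:~R <= expR (deg D)].

Lemma divisor_interval0 (R : realType) (D : arakelov_divisor R) :
  divisor_interval D 0.
Proof. by rewrite /divisor_interval /= mulr0z oppr_le0 expR_ge0. Qed.

Definition arakelov_H0 {R : realType} (D : arakelov_divisor R) : subSmod :=
  HZ_sub (divisor_interval0 D).

(* Intended for M = (HZ)_X, where level1 M = X and the last condition says that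
   the family of the elements of Z belongs to (HZ)_X(Z_+). *)
Definition generates (M : subSmod) (G : {fset int}) : Prop :=
  (forall g, g \in G -> level1 M g) /\
  forall x, level1 M x ->
    exists Z : {fset int},
      [/\ (Z `<=` G)%fset,
          \sum_(g <- Z) g = x
        & forall Z' : {fset int}, (Z' `<=` Z)%fset ->
            level1 M (\sum_(g <- Z') g)].

(* The value is 0 by default when no finite generating set exists. *)
Definition dimS (M : subSmod) : nat :=
  xget 0%N (is_least [set #|` G|%fset | G in generates M]).

(* Main.v *)
Require Import Defs.
From mathcomp Require Import all_boot all_order all_algebra.
From mathcomp Require Import finmap.
From mathcomp Require Import all_classical all_reals all_analysis.
From mathcomp Require Import zify.
Import Order.TTheory GRing.Theory Num.Theory.
Local Open Scope ring_scope.

(** Let N be the integer part of exp (deg D), so that H^0(D)(1_+) is the set of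
    integers of [-N, N], and let m be the integer with 2^(m-1) <= N < 2^m, which
    is the strict ceiling of deg_2 D. A generating set G has at least 2N + 1 > 2^m
    subset sums, hence more than m elements. Conversely 1, 2, ..., 2^(m-1), -N
    generate: x >= 0 is a sum of distinct powers of 2, and x < 0 is -N plus the
    binary expansion of N + x; all partial sums of these stay in [-N, N]. *)

Lemma is_least_unique {d : Order.disp_t} {T : porderType d} (A : set T)
    (m n : T) : is_least A m -> is_least A n -> m = n.
Proof.
by move=> [Am lem] [An len]; apply/eqP; rewrite eq_le lem// len.
Qed.

Lemma sum_fset_ge0 (A : {fset int}) :
  (forall a, a \in A -> 0 <= a) -> 0 <= \sum_(a <- A) a.
Proof. by move=> A_ge0; rewrite big_seq sumr_ge0. Qed.

Lemma le_sum_fset (A B : {fset int}) : (forall b, b \in B -> 0 <= b) ->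
  (A `<=` B)%fset -> \sum_(a <- A) a <= \sum_(b <- B) b.
Proof.
move=> B_ge0 AB; rewrite (big_fsetID _ (mem A) B)/=.
have -> : [fset x | x in B & x \in A]%fset = A.
  by apply/fsetP => x; rewrite !inE/= andbC; case: (boolP (x \in A)) => //= /(fsubsetP AB).
rewrite lerDl sum_fset_ge0// => b; rewrite !inE/= => /andP[bB _].
exact: B_ge0.
Qed.

Definition pow2s (m : nat) : {fset int} := [fset (2 ^ i)%N%:Z | i in iota 0 m]%fset.

Lemma pow2sP (m : nat) (x : int) :
  reflect (exists2 i, (i < m)%N & x = (2 ^ i)%N%:Z) (x \in pow2s m).
Proof.
apply: (iffP idP) => [/imfsetP[/= i + ->]|[i im ->]].
  by rewrite mem_iota; exists i.
by apply/imfsetP; exists i; rewrite //= mem_iota.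
Qed.

Lemma card_pow2s_le (m : nat) : (#|` pow2s m| <= m)%N.
Proof.
by apply: leq_trans (leq_imfset_card _ _ _) _; rewrite /= undup_id ?iota_uniq ?size_iota.
Qed.

(** Induction on [m]: if [x] is at least 2^m, split off 2^m. The rest is below 2^m, so its expansion
    uses only smaller powers and 2^m occurs once. *)
Lemma binary_expansion (m x : nat) : (x < 2 ^ m)%N ->
  exists2 Z : {fset int}, (Z `<=` pow2s m)%fset & \sum_(g <- Z) g = x%:Z.
Proof.
elim: m x => [|m IH] x xm.
  by exists fset0; rewrite ?fsub0set// big_seq_fset0; move: xm; rewrite expn0; lia.
have sub : (pow2s m `<=` pow2s m.+1)%fset.
  apply/fsubsetP => y /pow2sP[i im ->]; apply/pow2sP; exists i => //.
  exact: ltnW.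
have [/IH[Z Zm Zx]|mx] := ltnP x (2 ^ m).
  by exists Z => //; apply: fsubset_trans sub.
have [|Z Zm Zx] := IH (x - 2 ^ m)%N; first by move: xm; rewrite expnS; lia.
exists ((2 ^ m)%N%:Z |` Z)%fset.
  rewrite fsubUset fsub1set (fsubset_trans Zm sub) andbT.
  by apply/pow2sP; exists m.
rewrite big_fsetU1/= ?Zx; first by lia.
apply/negP => /(fsubsetP Zm)/pow2sP[i im [/eqP]].
by rewrite eqn_exp2l// gtn_eqF.
Qed.

(** The subset sums of [G] are the image of its power set, which has 2^|G| elements. *)
Lemma card_subset_sums (s : seq int) (G : {fset int}) : uniq s ->
  (forall x, x \in s ->
    exists2 Z : {fset int}, (Z `<=` G)%fset & \sum_(g <- Z) g = x) ->
  (size s <= 2 ^ #|` G|)%N.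
Proof.
move=> us sG; rewrite -card_fpowerset.
rewrite -(size_map (fun Z : {fset int} => \sum_(g <- Z) g)).
apply: uniq_leq_size us _ => x /sG[Z ZG <-].
by apply/mapP; exists Z => //; rewrite fpowersetE.
Qed.

Section interval.
Variables (M : subSmod) (N : nat).
Hypothesis level1M : forall x, level1 M x <-> - N%:Z <= x <= N%:Z.

Lemma generates_card (G : {fset int}) :
  generates M G -> (2 * N + 1 <= 2 ^ #|` G|)%N.
Proof.
move=> [_ genG].
have <- : size [seq i%:Z - N%:Z | i <- iota 0 (2 * N + 1)] = (2 * N + 1)%N.
  by rewrite size_map size_iota.
apply: card_subset_sums.
  by rewrite map_inj_uniq ?iota_uniq// => i j; lia.
move=> x /mapP[i]; rewrite mem_iota => iN xE.
have [|Z [ZG Zx _]] := genG x; first by apply/level1M; lia.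
by exists Z.
Qed.

(** Here [m] is one less than in the overview. The bound 2^m <= N keeps the powers of 2 inside
    [-N, N], and N < 2^(m+1) makes their sums reach all of [0, N]. *)
Lemma generates_pow2s (m : nat) : (0 < N)%N -> (2 ^ m <= N < 2 ^ m.+1)%N ->
  generates M (- N%:Z |` pow2s m.+1)%fset.
Proof.
move=> N0 /andP[mN Nm]; split=> [g|x].
  move=> /fset1UP[->|/pow2sP[i im ->]]; apply/level1M; first lia.
  by have := @leq_pexp2l 2 i m isT im; lia.
have pow2_gt0 (Z : {fset int}) :
    (Z `<=` pow2s m.+1)%fset -> forall z, z \in Z -> 0 < z.
  by move=> /fsubsetP Zm z /Zm /pow2sP[i _ ->]; rewrite ltz_nat expn_gt0.
move=> /level1M/andP[Nx xN].
have [x0|x0] := leP 0 x.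
  have [|Z Zm Zx] := @binary_expansion m.+1 `|x|%N; first lia.
  exists Z; split; first exact: fsubset_trans (fsubsetU1 _ _).
    by rewrite Zx; lia.
  (* All terms are positive, so a partial sum lies in [0, x]. *)
  move=> W WZ; apply/level1M.
  have W0 := @sum_fset_ge0 W (fun w wW => ltW (pow2_gt0 _ (fsubset_trans WZ Zm) w wW)).
  have := @le_sum_fset W Z (fun z zZ => ltW (pow2_gt0 _ Zm z zZ)) WZ.
  rewrite Zx; lia.
have [|Z Zm Zx] := @binary_expansion m.+1 (absz (N%:Z + x)); first lia.
exists (- N%:Z |` Z)%fset; split; first exact: fsetUS.
  rewrite big_fsetU1/= ?Zx; first lia.
  by apply/negP => /(pow2_gt0 _ Zm); lia.
move=> W WZ; apply/level1M.
(* Apart from -N, the terms of [W] sum to a value in [0, N + x]. With -N the sum is in [-N, x], and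
   x < 0; without it, the sum is below N. *)
have W'Z : (W `\ - N%:Z `<=` Z)%fset by rewrite fsubDset.
have W'0 := @sum_fset_ge0 _ (fun w wW => ltW (pow2_gt0 _ (fsubset_trans W'Z Zm) w wW)).
have := le_sum_fset _ _ (fun z zZ => ltW (pow2_gt0 _ Zm z zZ)) W'Z.
have [NW|NW] := boolP (- N%:Z \in W).
  move: W'0; rewrite (big_fsetD1 _ NW)/= Zx; move: (\sum_(_ <- _) _) => S; lia.
move: W'0; rewrite mem_fsetD1// Zx; lia.
Qed.

Lemma dimS_interval (m : nat) : (0 < N)%N -> (2 ^ m <= N < 2 ^ m.+1)%N ->
  dimS M = m.+2.
Proof.
move=> N0 mN.
have lb G : generates M G -> (m.+1 < #|` G|)%N.
  (* 2^(m+1) <= 2N < 2N + 1 <= 2^|G|. *)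
  move=> /generates_card; rewrite -(@ltn_exp2l 2)// expnS.
  by move: mN; lia.
have least : is_least [set #|` G|%fset | G in generates M]%classic m.+2.
  split; last by move=> _ [G genG <-]; exact: lb.
  have genG := generates_pow2s m N0 mN; eexists; first exact: genG.
  (* Only the upper bound on the cardinality is counted; [lb] gives the other one, so no
     distinctness of the generators has to be checked. *)
  apply/eqP; rewrite eqn_leq lb// andbT cardfsU1.
  by rewrite -(add1n m.+1) leq_add ?leq_b1 ?card_pow2s_le.
by apply: xget_unique => // n nleast; apply: is_least_unique nleast least.
Qed.

End interval.

Lemma deg2_lt_nat (R : realType) (D : arakelov_divisor R) (n : nat) :
  (deg2 D < n%:R) = (expR (deg D) < 2 ^+ n).
Proof.
have ln2 : 0 < ln 2 :> R by rewrite ln_gt0// ltr1n.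
rewrite /deg2 ltr_pdivrMr// -[LHS]ltr_expR expRM_natl lnK//.
by rewrite posrE.
Qed.

Theorem theorem3p3 (R : realType) (D : arakelov_divisor R) (degD : 0 <= deg D) :
  (dimS (arakelov_H0 D))%:Z = strict_ceil (deg2 D) + 1.
Proof.
have [/= + least] := strict_ceil_least (deg2 D).
have ln2 : 0 < ln 2 :> R by rewrite ln_gt0// ltr1n.
have deg20 : 0 <= deg2 D by rewrite divr_ge0// ltW.
(* Since deg_2 D >= 0, its strict ceiling is positive, hence of the form m + 1. *)
case E : (strict_ceil (deg2 D)) => [[|m]|m] ub; last 1 first.
- by have := lt_trans ub (_ : _ < 0); rewrite ltrz0 => /(_ isT); rewrite ltNge deg20.
- by move: ub; rewrite ltNge deg20.
have exp_ub : expR (deg D) < 2 ^+ m.+1 by rewrite -deg2_lt_nat.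
have exp_lb : 2 ^+ m <= expR (deg D).
  (* Otherwise [m] would also exceed deg_2 D, against the minimality of m + 1. *)
  rewrite leNgt -deg2_lt_nat; apply/negP => /(least m%:Z).
  by rewrite E lez_nat ltnn.
(* An integer is at most exp (deg D) exactly when it is at most N. *)
have := floor_ge_int (expR (deg D)); set N := Num.floor _ => floorE.
have N1 : 1 <= N by rewrite floorE -expR0 ler_expR.
have mN : (2 ^ m)%N%:Z <= N by rewrite floorE -pmulrn natrX.
have Nm : N < (2 ^ m.+1)%N%:Z by rewrite ltNge floorE -ltNge -pmulrn natrX.
rewrite (dimS_interval _ `|N|%N _ m); [lia| |lia|lia].
move=> x; rewrite level1_HZ_sub /divisor_interval/=.
(* The lower bound on [x] is the upper bound on [-x], so the floor serves both ends. *)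
by rewrite lerNl -rmorphN/= -!floorE; lia.
Qed.
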